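(* Let $G$ be a finite connected regularly diagonal undirected graph, with eulerian magnitude homology groups $\mathrm{EMH}_{k,k}(G)=0$ in all bidegrees $(k,k)$ for $k>n$. Then $G$ is the complete graph on $n+1$ vertices.
   Context: Undirected graphs are simple, and $R$ is a fixed commutative unital ring. For a finite connected undirected graph $G$ with vertex set $V(G)$, $d_G$ denotes the path metric. The length of a tuple $(x_0,\dots,x_k)$ of vertices is $\mathrm{len}(x_0,\dots,x_k)=\sum_{i=0}^{k-1}d_G(x_i,x_{i+1})$. The eulerian magnitude chain module $\mathrm{EMC}_{k,\ell}(G)$ is the free $R$-module on the tuples $(x_0,\dots,x_k)\in V(G)^{k+1}$ of pairwise distinct vertices of length $\ell$. The differential $\partial\colon \mathrm{EMC}_{k,\ell}(G)\to \mathrm{EMC}_{k-1,\ell}(G)$ is $\partial=\sum_{i=1}^{k-1}(-1)^i\partial_i$, where $\partial_i$ deletes the entry $x_i$ if the resulting tuple still has length $\ell$, and $\partial_i(x_0,\dots,x_k)=0$ otherwise. The eulerian magnitude homology is $\mathrm{EMH}_{k,\ell}(G)=H_k(\mathrm{EMC}_{*,\ell}(G),\partial)$. The graph $G$ is called regularly diagonal if $\mathrm{EMH}_{k,\ell}(G)=0$ for all $k\neq \ell$.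
   Formalization: The formal theorem also assumes that EMH_{n,n}(G) is non-zero (n is the top non-vanishing diagonal degree) and that R is not the zero ring; without this the one-vertex graph with n = 5 is a counterexample. *)

(* Defs.v *)
From HB Require Import structures.
From mathcomp Require Import all_boot all_order all_algebra.
From mathcomp Require Import boolp.

Set Implicit Arguments.
Unset Strict Implicit.
Unset Printing Implicit Defensive.

Import GRing.Theory.
Local Open Scope ring_scope.
Local Open Scope quotient_scope.

Record connGraph := ConnGraph {
  vertex :> finType;
  edge : rel vertex;
  edge_sym : symmetric edge;
  edge_irrefl : irreflexive edge;
  edge_connected : forall x y : vertex, connect edge x y
}.

Definition complete_graph (G : connGraph) : Prop :=
  forall x y : G, edge x y = (x != y).

Section PathMetric.
Variable G : connGraph.
Implicit Types x y : G.

Definition has_walk x y (m : nat) : bool :=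
  [exists p : m.-tuple G, path (@edge G) x p && (last x p == y)].

Lemma has_walk_exists x y : exists m, has_walk x y m.
Proof.
have /connectP[p ep yE] := edge_connected x y.
by exists (size p); apply/existsP; exists (in_tuple p); rewrite ep /= -yE.
Qed.

Definition dist x y : nat := ex_minn (has_walk_exists x y).

Definition len k (t : k.+1.-tuple G) : nat :=
  (\sum_(i < k)
     dist (tnth t (widen_ord (leqnSn k) i)) (tnth t (lift ord0 i)))%N.

Definition del k (t : k.+2.-tuple G) (i : 'I_k.+2) : k.+1.-tuple G :=
  [tuple tnth t (lift i j) | j < k.+1].

Definition emtuple k l : Type :=
  {t : k.+1.-tuple G | uniq t && (len t == l)}.
HB.instance Definition _ k l := Finite.on (emtuple k l).
HB.instance Definition _ k l := SubType.on (emtuple k l).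

End PathMetric.

(* The R-module ker g / im f of a pair of linear maps A -f-> B -g-> C; the
   image is pulled back to ker g, so it is the homology at B when g \o f = 0.
   Membership in the image is not decidable over a general ring, hence the
   classical boolean `[< _ >]. *)
Section Homology.
Variables (R : pzRingType) (A B C : lmodType R).
Variables (f : {linear A -> B}) (g : {linear B -> C}).

Definition cycle_pred : {pred B} := fun b => g b == 0.

Lemma cycle_submod : submod_closed cycle_pred.
Proof.
split=> [|a u v]; rewrite /cycle_pred !unfold_in /= ?linear0 // linearP.
by move=> /eqP-> /eqP->; rewrite scaler0 addr0.
Qed.
HB.instance Definition _ :=
  GRing.isSubmodClosed.Build R B cycle_pred cycle_submod.

Definition cycles : Type := {b : B | b \in cycle_pred}.
HB.instance Definition _ := Choice.on cycles.
HB.instance Definition _ := SubType.on cycles.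
HB.instance Definition _ := [SubChoice_isSubLmodule of cycles by <:].

Definition boundary_pred : {pred cycles} :=
  fun z => `[< exists a, f a = val z >].

Lemma boundary_submod : submod_closed boundary_pred.
Proof.
split=> [|c u v].
  by apply/asboolP; exists 0; rewrite !linear0.
move=> /asboolP[a fa] /asboolP[b fb]; apply/asboolP.
by exists (c *: a + b); rewrite !linearP fa fb.
Qed.
HB.instance Definition _ :=
  GRing.isSubmodClosed.Build R cycles boundary_pred boundary_submod.

Definition homology : Type := Quotient.quot boundary_pred.
HB.instance Definition _ := GRing.Zmodule.on homology.

Definition homology_class (z : cycles) : homology := \pi_(Quotient.quot boundary_pred) z.

Definition homology_scale (c : R) (h : homology) : homology :=
  homology_class (c *: repr (h : Quotient.quot boundary_pred)).

Lemma homology_classZ c z :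
  homology_scale c (homology_class z) = homology_class (c *: z).
Proof.
apply/eqP; rewrite /homology_scale /homology_class.
rewrite -Quotient.idealrBE -scalerBr rpredZ //.
by rewrite Quotient.idealrBE reprK.
Qed.

Lemma homology_classP (h : homology) : {z | h = homology_class z}.
Proof.
exists (repr (h : Quotient.quot boundary_pred)).
by rewrite /homology_class reprK.
Qed.

Lemma homology_classD z w :
  homology_class (z + w) = homology_class z + homology_class w.
Proof. exact: raddfD. Qed.

Lemma homology_class_eq0 z :
  homology_class z = 0 <-> exists a, f a = val z.
Proof.
have <- : homology_class 0 = 0 by exact: raddf0.
split=> [/eqP|zb]; rewrite /homology_class.
  by rewrite -Quotient.idealrBE subr0 => /asboolP.
by apply/eqP; rewrite -Quotient.idealrBE subr0; apply/asboolP.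
Qed.

Fact homology_scaleA a b h :
  homology_scale a (homology_scale b h) = homology_scale (a * b) h.
Proof.
by have [z ->] := homology_classP h; rewrite !homology_classZ scalerA.
Qed.

Fact homology_scale1 : left_id 1 homology_scale.
Proof.
by move=> h; have [z ->] := homology_classP h; rewrite homology_classZ scale1r.
Qed.

Fact homology_scaleDr : right_distributive homology_scale +%R.
Proof.
move=> a h1 h2; have [z ->] := homology_classP h1.
have [w ->] := homology_classP h2.
by rewrite -homology_classD !homology_classZ scalerDr homology_classD.
Qed.

Fact homology_scaleDl h :
  {morph homology_scale^~ h : a b / a + b}.
Proof.
move=> a b; have [z ->] := homology_classP h.
by rewrite !homology_classZ scalerDl homology_classD.
Qed.

HB.instance Definition _ := GRing.Zmodule_isLmodule.Build R homology
  homology_scaleA homology_scale1 homology_scaleDr homology_scaleDl.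

End Homology.

Section EulerianMagnitude.
Variables (R : comNzRingType) (G : connGraph).

Definition EMC k l : Type := {ffun emtuple G k l -> R^o}.
HB.instance Definition _ k l := GRing.Lmodule.on (EMC k l).

Definition gen k l (s : emtuple G k l) : EMC k l :=
  [ffun u => (u == s)%:R].

(* Entries stay pairwise distinct under deletion, so [insub] returns [None]
   exactly when the length drops. *)
Definition face k l (i : 'I_k.+2) (t : emtuple G k.+1 l) : EMC k l :=
  if (insub (del (val t) i) : option (emtuple G k l)) is Some s
  then gen s else 0.

Definition EMC_diffS k l (c : EMC k.+1 l) : EMC k l :=
  \sum_(t : emtuple G k.+1 l)
     (c t : R) *: \sum_(i < k.+2 | (0 < i <= k)%N) (-1) ^+ i *: face i t.

(* In degree 0 the differential is zero; its target EMC_{-1,l} = 0 is replaced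
   by EMC_{0,l}, which does not affect the kernel. *)
Definition EMC_diff k l : EMC k l -> EMC k.-1 l :=
  if k is k'.+1 then @EMC_diffS k' l else fun=> 0.

Lemma EMC_diff_linear k l : linear (@EMC_diff k l).
Proof.
case: k => [|k] a u v /=; first by rewrite scaler0 addr0.
rewrite /EMC_diffS scaler_sumr -big_split /=; apply: eq_bigr => t _.
by rewrite !ffunE scalerDl scalerA.
Qed.
HB.instance Definition _ k l :=
  GRing.isLinear.Build R (EMC k l) (EMC k.-1 l) _ (@EMC_diff k l)
    (@EMC_diff_linear k l).

Definition EMH k l : lmodType R :=
  homology (@EMC_diff k.+1 l : {linear EMC k.+1 l -> EMC k l})
           (@EMC_diff k l : {linear EMC k l -> EMC k.-1 l}).

End EulerianMagnitude.

Definition trivial_module (R : pzRingType) (M : lmodType R) : Prop :=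
  forall x : M, x = 0.

Definition regularly_diagonal (R : comNzRingType) (G : connGraph) : Prop :=
  forall k l : nat, k <> l -> trivial_module (EMH R G k l).

(* Main.v *)
Require Import Defs.
From mathcomp Require Import all_boot all_order all_algebra.

Set Implicit Arguments.
Unset Strict Implicit.
Unset Printing Implicit Defensive.

Import GRing.Theory.

(** Let N be the number of vertices and let t be an ordering of all the vertices
whose length L is maximal among such orderings.  Deleting an entry of t and
appending it at the end gives another ordering of all the vertices, so the
deletion has length strictly below L.  Hence t is a cycle of EMC_{N-1,L}, and it
is not a boundary because EMC_{N,L} = 0: EMH_{N-1,L} is non-zero.  Regular
diagonality forces L = N-1, so that vertices which are consecutive in some
ordering, that is any two distinct vertices, are adjacent; moreover
EMH_{N-1,N-1} is non-zero, while EMH_{k,k} = 0 for k >= N. *)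

Section Dist.
Variable G : connGraph.
Implicit Types x y : G.

Lemma dist_gt0 x y : x != y -> 0 < dist x y.
Proof.
rewrite /dist; case: ex_minnP => -[|m] //.
by move=> /existsP[p]; rewrite tuple0 /= => ->.
Qed.

Lemma dist_le1_edge x y : x != y -> dist x y <= 1 -> edge x y.
Proof.
rewrite /dist; case: ex_minnP => -[|[|m]] // /existsP[p].
  by rewrite tuple0 /= => ->.
by case/tupleP: p => z p; rewrite tuple0 /= andbT => /andP[xz /eqP <-].
Qed.

Lemma len_cons k x (t : k.+1.-tuple G) :
  len [tuple of x :: t] = dist x (thead t) + len t.
Proof.
rewrite /len big_ord_recl /=; congr (dist _ _ + _).
  by rewrite tnthS.
apply: eq_bigr => i _; congr dist; last by rewrite tnthS.
by rewrite !(tnth_nth x).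
Qed.

Lemma len_rcons k (t : k.+1.-tuple G) x :
  len [tuple of rcons t x] = len t + dist (tnth t ord_max) x.
Proof.
rewrite /len big_ord_recr /=; congr (_ + _); last first.
  congr dist; rewrite !(tnth_nth x) /= nth_rcons size_tuple ?ltnSn //.
  by rewrite /bump /= add1n ltnn eqxx.
apply: eq_bigr => i _; congr dist;
  rewrite !(tnth_nth x) /= nth_rcons size_tuple.
  by rewrite ltnS ltnW.
by rewrite /bump /= add1n ltnS ltn_ord.
Qed.

Lemma len_uniq_ge k (t : k.+1.-tuple G) : uniq t -> k <= len t.
Proof.
move=> /tuple_uniqP t_inj; rewrite -[k in k <= _]card_ord -sum1_card.
(* Consecutive entries are distinct, so each of the [k] summands is at least 1. *)
apply: leq_sum => i _; apply: dist_gt0.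
by rewrite (inj_eq t_inj) -val_eqE /= /bump add1n neq_ltn ltnSn.
Qed.

(** Moving one entry to the end only permutes the tuple; this makes a deletion comparable with a
    tuple of the original size. *)
Lemma uniq_rcons_del k (t : k.+2.-tuple G) i :
  uniq t -> uniq (rcons (del t i) (tnth t i)).
Proof.
move=> /tuple_uniqP t_inj; rewrite rcons_uniq; apply/andP; split.
  apply/negP => /tnthP[j]; rewrite tnth_mktuple => /t_inj /eqP.
  exact/negP/neq_lift.
apply/tuple_uniqP => j1 j2; rewrite !tnth_mktuple => /t_inj; exact: lift_inj.
Qed.

Lemma len_del_lt k (t : k.+2.-tuple G) i :
  uniq t -> (forall u : k.+2.-tuple G, uniq u -> len u <= len t) ->
  len (del t i) < len t.
Proof.
move=> t_uniq t_max; have u_uniq := uniq_rcons_del i t_uniq.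
apply: leq_trans (t_max [tuple of rcons (del t i) (tnth t i)] u_uniq).
rewrite len_rcons -addn1 leq_add2l dist_gt0 //.
move: u_uniq; rewrite rcons_uniq => /andP[+ _]; apply: contraNneq => <-.
exact: mem_tnth.
Qed.

End Dist.

(** Later arguments work with exactness at [B] and never open the quotient. Since boundaries are
    taken inside the kernel of [g], no relation between [f] and [g] is needed. *)
Lemma trivial_homology (R : pzRingType) (A B C : lmodType R)
    (f : {linear A -> B}) (g : {linear B -> C}) :
  trivial_module (homology f g) <->
  forall b, g b = 0%R -> exists a, f a = b.
Proof.
split=> [triv b gb0 | exact_fg h].
  have bP : b \in cycle_pred g by rewrite unfold_in; apply/eqP.
  have [a fa] := (homology_class_eq0 f (Sub b bP : cycles g)).1 (triv _).
  by exists a; rewrite fa.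
have [z ->] := homology_classP h; apply/homology_class_eq0/exact_fg.
exact/eqP/(valP z).
Qed.

Section TopDegree.
Variables (R : comNzRingType) (G : connGraph).
Local Open Scope ring_scope.

Lemma emtuple_card k l (t : emtuple G k l) : (k < #|G|)%N.
Proof.
have /andP[/card_uniqP t_card _] := valP t.
by rewrite -(size_tuple (val t)) -t_card max_card.
Qed.

Lemma EMC_eq0 k l (c : EMC R G k l) : (#|G| <= k)%N -> c = 0.
Proof.
move=> leGk; apply/ffunP => t; have := emtuple_card t.
by rewrite ltnNge leGk.
Qed.

Lemma EMH_trivial_ge_card k l : (#|G| <= k)%N -> trivial_module (EMH R G k l).
Proof.
by move=> leGk; apply/trivial_homology => c _; exists 0; rewrite linear0 (EMC_eq0 c).
Qed.

Lemma gen_neq0 k l (s : emtuple G k l) : gen R s != 0.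
Proof.
(* The coefficient at [s] is 1, which differs from 0 in [R]. *)
apply/eqP => /ffunP/(_ s); rewrite !ffunE eqxx => /eqP.
by rewrite oner_eq0.
Qed.

Lemma diff_gen_max k l (s : emtuple G k l) :
  (forall u : k.+1.-tuple G, uniq u -> (len u <= len (val s))%N) ->
  EMC_diff (gen R s) = 0.
Proof.
case: k s => [|k] s s_max //=; rewrite /EMC_diffS big1 // => t _.
rewrite ffunE; case: eqP => [->|_]; last by rewrite scale0r.
rewrite scale1r big1 // => i _.
have /andP[s_uniq /eqP s_len] := valP s.
have := len_del_lt i s_uniq s_max.
(* The deletion is too short to be an [emtuple] of length [l], so [face] takes its default value
   0. *)
rewrite s_len /face => lt_l; rewrite insubF ?scaler0 //.
by rewrite (ltn_eqF lt_l) andbF.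
Qed.

Lemma EMH_top_nontrivial k (t : k.+1.-tuple G) : #|G| = k.+1 -> uniq t ->
  (forall u : k.+1.-tuple G, uniq u -> (len u <= len t)%N) ->
  ~ trivial_module (EMH R G k (len t)).
Proof.
move=> cardG t_uniq t_max /trivial_homology exact_top.
have tP : uniq t && (len t == len t) by rewrite t_uniq eqxx.
have [|a] := exact_top (gen R (Sub t tP : emtuple G k (len t))).
  exact: diff_gen_max.
(* The chain [a] has degree [k.+1], where no tuple of distinct vertices exists. *)
rewrite (EMC_eq0 a) ?cardG // linear0 => /esym/eqP.
exact/negP/gen_neq0.
Qed.

End TopDegree.

Lemma max_len_ordering (G : connGraph) k : #|G| = k.+1 ->
  exists2 t : k.+1.-tuple G, uniq t &
    forall u : k.+1.-tuple G, uniq u -> len u <= len t.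
Proof.
move=> cardG; have enumP : size (enum G) == k.+1 by rewrite -cardE cardG.
have [|t t_uniq t_max] := @arg_maxnP _ (Tuple enumP) (fun u => uniq u) (@len G k).
  exact: enum_uniq.
by exists t.
Qed.

(** List all vertices with [x] and [y] first. The part from [y] on already has length at least
    [k - 1], which leaves at most 1 for [dist x y]. *)
Lemma complete_of_len_le (G : connGraph) k : #|G| = k.+1 ->
  (forall u : k.+1.-tuple G, uniq u -> len u <= k) -> complete_graph G.
Proof.
move=> cardG len_le x y; have [<-|neq_xy] := eqVneq x y.
  by rewrite edge_irrefl.
apply: dist_le1_edge => //.
pose s := rem y (rem x (enum G)).
have y_rem : y \in rem x (enum G).
  by rewrite mem_rem_uniq ?enum_uniq // !inE eq_sym neq_xy mem_enum.
have perm_s : perm_eq (x :: y :: s) (enum G).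
  rewrite perm_sym (permPl (perm_to_rem (mem_enum G x))) perm_cons.
  exact: perm_to_rem.
have s_uniq : uniq (x :: y :: s) by rewrite (perm_uniq perm_s) enum_uniq.
have := perm_size perm_s; rewrite -cardE cardG => -[].
case: k cardG len_le => [|k] // _ len_le [/eqP s_size].
have /= := len_le [tuple of x :: [tuple of y :: Tuple s_size]] s_uniq.
have /andP[_ ys_uniq] := s_uniq.
have := @len_uniq_ge _ _ [tuple of y :: Tuple s_size] ys_uniq.
rewrite len_cons theadE => le_k /(leq_trans (leq_add (leqnn _) le_k)).
by rewrite -add1n leq_add2r.
Qed.

Theorem theorem2p12 (R : comNzRingType) (G : connGraph) (n : nat) :
  regularly_diagonal R G ->
  (forall k : nat, (n < k)%N -> trivial_module (EMH R G k k)) ->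
  ~ trivial_module (EMH R G n n) ->
  complete_graph G /\ #|G| = n.+1.
Proof.
move=> diag vanish nontriv.
(* Non-vanishing in degree [n] bounds [n] from above. *)
have lt_nG : n < #|G|.
  by rewrite ltnNge; apply/negP => /(@EMH_trivial_ge_card R G n n).
case cardG: #|G| lt_nG => [|k] // lt_nk.
have [t t_uniq t_max] := max_len_ordering cardG.
have top := @EMH_top_nontrivial R G k t cardG t_uniq t_max.
have len_t : len t = k.
  by apply/eqP; apply: contra_notT top => /eqP neq; apply: diag => /esym.
split.
  (* Maximality of [t] carries the bound [k] over to every ordering. *)
  by apply: (complete_of_len_le cardG) => u /t_max; rewrite len_t.
congr _.+1; apply/eqP; rewrite eqn_leq -[n <= k]ltnS lt_nk andbT leqNgt.
(* If [n < k], then [vanish] would kill the non-zero group of [top], which lies on the diagonal by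
   [len_t]. *)
by apply/negP => /vanish; rewrite -[X in EMH R G k X]len_t.
Qed.
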